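(* Let $D=(V,A)$ be a finite loopless digraph, $F\subseteq A$ a non-empty subset of edges, and $B$ an integral $0$-base-polyhedron. Let $f:A\to\mathbb{Z}\cup\{-\infty\}$, $g:A\to\mathbb{Z}\cup\{+\infty\}$ with $f\le g$ be such that $Q(f,g;B)\cap\mathbb{Z}^A$ is non-empty. Then there exists an $F$-dec-min element of $Q(f,g;B)\cap\mathbb{Z}^A$ if and only if the digraph $D^*=(V,A^* )$ has no directed circuit containing an edge of $F$.
   Context: For $x\in\mathbb{R}^V$, $\widetilde x(Z)=\sum_{v\in Z}x(v)$. A base-polyhedron is $B'(p)=\{x:\widetilde x(V)=p(V),\ \widetilde x(Z)\ge p(Z)\ \forall Z\subset V\}$ with $p:2^V\to\mathbb{Z}\cup\{-\infty\}$, $p(\emptyset)=0$, $p(V)$ finite, $p(X)+p(Y)\le p(X\cap Y)+p(X\cup Y)$; $0$-base-polyhedron: $p(V)=0$; integral: $p$ integer-valued where finite. For $x:A\to\mathbb{R}$, $\psi_x(v)=\sum_{uv\in A}x(uv)-\sum_{vu\in A}x(vu)$; $Q(f,g;B)=\{x\in\mathbb{R}^A:f\le x\le g,\ \psi_x\in B\}$. Let $\mathcal P=\{Z\subseteq V:\min\{\widetilde x(Z):x\in B\}>-\infty\}$; it is closed under union and intersection and contains $V$, so each $u\in V$ lies in a unique smallest member $P(u)$ of $\mathcal P$. Jumping edges: $J=\{uv: v\in P(u)-u\}$. Let $A_1=\{e\in A: f(e)=-\infty\}$ (edges of $D$, same orientation) and $A_2=\{vu: uv\in A-F,\ g(uv)=+\infty\}$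 (reversed copies). $A^*$ is the disjoint union $J\cup A_1\cup A_2$ (a multigraph); the edges of $F$ that can occur in $A^*$ are those of $A_1\cap F$. For $y,y'\in\mathbb{R}^F$, $y$ is decreasingly smaller than $y'$ if its decreasingly sorted component sequence is lexicographically smaller; $z\in S$ is $F$-dec-min in $S$ if no $z'\in S$ has $z'|_F$ decreasingly smaller than $z|_F$. *)

(* Defs.v *)
From HB Require Import structures.
From mathcomp Require Import all_boot all_order all_algebra.
From mathcomp Require Import boolp classical_sets reals constructive_ereal ereal.

Set Implicit Arguments.
Unset Strict Implicit.
Unset Printing Implicit Defensive.

Import Order.TTheory GRing.Theory Num.Theory.
Local Open Scope ring_scope.

(* Values in Z with +oo and -oo are elements of \bar int; this is the
   embedding into the extended reals. *)
Definition toR (R : realType) (m : \bar int) : \bar R :=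
  er_map (fun k : int => k%:~R) m.

Definition tsum (R : realType) (V : finType) (x : V -> R) (Z : {set V}) : R :=
  \sum_(v in Z) x v.

Definition supermodular_border (V : finType) (p : {set V} -> \bar int) : Prop :=
  [/\ forall Z, p Z != +oo%E,
      p finset.set0 = 0%E,
      p [set: V]%SET \is a fin_num &
      forall X Y : {set V}, (p X + p Y <= p (X :&: Y)%SET + p (X :|: Y)%SET)%E].

Definition base_polyhedron (R : realType) (V : finType)
    (p : {set V} -> \bar int) : set (V -> R) :=
  fun x => (tsum x [set: V]%SET)%:E = toR R (p [set: V]%SET) /\
           forall Z : {set V}, (toR R (p Z) <= (tsum x Z)%:E)%E.

Definition integral_0_base_polyhedron (R : realType) (V : finType)
    (B : set (V -> R)) : Prop :=
  exists p : {set V} -> \bar int,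
    [/\ supermodular_border p, p [set: V]%SET = 0%E & B = base_polyhedron p].

Section Digraph.
(* The edges form a finite type A with end maps src and tgt, so that parallel
   edges are allowed; an edge e goes from src e to tgt e. *)
Variables (R : realType) (V A : finType) (src tgt : A -> V).

Definition psi (x : A -> R) (v : V) : R :=
  \sum_(e | tgt e == v) x e - \sum_(e | src e == v) x e.

Definition Qset (f g : A -> \bar int) (B : set (V -> R)) : set (A -> R) :=
  fun x => (forall e, (toR R (f e) <= (x e)%:E <= toR R (g e))%E) /\ B (psi x).

Definition integer_points : set (A -> R) :=
  fun x => forall e, x e \is a Num.int.

(* The set system of those Z for which min {x~(Z) : x in B} is not -oo. *)
Definition bounded_sets (B : set (V -> R)) : {set {set V}} :=
  [set Z : {set V} |
    (-oo < ereal_inf (image B (fun x => (tsum x Z)%:E)))%E]%SET.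

(* [bounded_sets B] is closed under intersection and contains V when B is a
   0-base-polyhedron, so this intersection is its smallest member containing
   u. *)
Definition smallest_member (B : set (V -> R)) (u : V) : {set V} :=
  (\bigcap_(Z in bounded_sets B | u \in Z) Z)%SET.

(* The edges that may occur in A^*. The three constructors keep the union
   J + A_1 + A_2 disjoint, and Keep and Rev remember the edge of D they come
   from. *)
Inductive star_edge :=
  | Jump of V & V
  | Keep of A
  | Rev of A.

Definition star_src (a : star_edge) : V :=
  match a with Jump u _ => u | Keep e => src e | Rev e => tgt e end.

Definition star_tgt (a : star_edge) : V :=
  match a with Jump _ v => v | Keep e => tgt e | Rev e => src e end.

Definition in_star (F : {set A}) (f g : A -> \bar int) (B : set (V -> R))
    (a : star_edge) : bool :=
  match a with
  | Jump u v => v \in (smallest_member B u :\ u)%SET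
  | Keep e => f e == -oo%E
  | Rev e => (e \notin F) && (g e == +oo%E)
  end.

(* Only the members of A_1 coming from F count as edges of F: a jumping edge
   parallel to an edge of F does not. *)
Definition star_in_F (F : {set A}) (a : star_edge) : bool :=
  if a is Keep e then e \in F else false.

Definition star_circuit (F : {set A}) (f g : A -> \bar int)
    (B : set (V -> R)) (c : seq star_edge) : Prop :=
  [/\ (0 < size c)%N,
      all (in_star F f g B) c,
      cycle (fun a b => star_tgt a == star_src b) c &
      uniq (map star_src c)].

Definition decr_seq (F : {set A}) (y : A -> R) : seq R :=
  sort >=%R [seq y e | e <- enum F].

Definition decreasingly_smaller (F : {set A}) (y y' : A -> R) : Prop :=
  ((decr_seq F y : seqlexi R) < (decr_seq F y' : seqlexi R))%O.

Definition dec_min (F : {set A}) (S : set (A -> R)) (z : A -> R) : Prop :=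
  S z /\ ~ exists z', S z' /\ decreasingly_smaller F z' z.

End Digraph.

(* Main.v *)
(* A circuit of [D^*] through an edge of [F] can be used to improve any feasible
   [x]: subtract 1 on its edges in [A_1] and add 1 on the originals of its edges
   in [A_2]. The in-flow vector then moves along the jumping edges of the
   circuit, which keeps it in [B], while [x] does not increase on [F] and
   decreases somewhere on [F].

   Conversely, let [e] in [F] lie on no circuit and have no finite lower bound,
   and let [Z] be the set reachable from the head of [e] in [D^*]. Then [e]
   enters [Z], the edges leaving [Z] have a finite lower bound, the edges
   entering [Z] lie in [F] or have a finite upper bound, and [p Z] is finite. So
   once [x] is bounded above on [F], the inequality [psi_x(Z) >= p Z] bounds
   [x e] from below. The integral points that are not worse than a given one
   therefore take only finitely many values on [F]. *)
Require Import Defs.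
From mathcomp Require Import all_boot all_order all_algebra.
From mathcomp Require Import boolp classical_sets reals constructive_ereal ereal.
From mathcomp Require Import lra.

Set Implicit Arguments.
Unset Strict Implicit.
Unset Printing Implicit Defensive.

Import Order.TTheory GRing.Theory Num.Theory.

(** * Comparison of decreasingly sorted sequences *)

Section DecreasingOrder.
Local Open Scope ring_scope.
Variables (R : realType) (A : finType) (F : {set A}).
Implicit Types (s t : seq R) (x y : A -> R).

(** Induction on both sequences: if the head [a] of [s] exceeded that of [t], the threshold [r = a]
    would count something in [s] and nothing in [t]. When the heads agree, dropping them preserves
    the count inequalities. *)
Lemma lexi_le_count s t :
  sorted >=%R s -> sorted >=%R t -> size s = size t ->
  (forall r, (count (fun a => (r <= a)%R) s <= count (fun a => (r <= a)%R) t)%N) ->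
  ((s : seqlexi R) <= (t : seqlexi R))%O.
Proof.
elim: s t => [|a s IH] [|b t] //= Ps Pt [szst] cnt.
have ge_trans : transitive (>=%R : rel R) by move=> u v w vu uw; exact: le_trans uw vu.
have /allP allt := order_path_min ge_trans Pt.
rewrite lexi_cons; apply/andP; split.
  rewrite leNgt; apply/negP => ba.
  have := cnt a; rewrite lexx leNgt ba /= add0n.
  have -> : count (fun c => (a <= c)%R) t = 0%N.
    apply/eqP; rewrite -leqn0 leqNgt -has_count; apply/hasPn => c /allt /= cb.
    by rewrite -ltNge (le_lt_trans cb).
  by rewrite ltnNge leq0n.
apply/implyP => ba.
apply: IH => //; [exact: path_sorted Ps|exact: path_sorted Pt|] => r.
have := cnt r.
case: (leP r a) => ra; case: (leP r b) => rb /=; rewrite ?leq_add2l ?add0n //.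
  by move=> /(leq_trans (leqnSn _)).
by have := lt_le_trans ra (le_trans rb ba); rewrite ltxx.
Qed.

Lemma size_decr_seq x : size (decr_seq F x) = #|F|.
Proof. by rewrite size_sort size_map cardE. Qed.

Lemma decr_seq_sorted x : sorted >=%R (decr_seq F x).
Proof. by apply: sort_sorted => a b; exact: le_total. Qed.

Lemma mem_decr_seq x e : e \in F -> x e \in decr_seq F x.
Proof. by move=> eF; rewrite mem_sort map_f ?mem_enum. Qed.

Lemma eq_decr_seq x y : {in F, x =1 y} -> decr_seq F x = decr_seq F y.
Proof.
by move=> xy; congr sort; apply/eq_in_map => e; rewrite mem_enum; exact: xy.
Qed.

Lemma sum_decr_seq x : \sum_(r <- decr_seq F x) r = \sum_(e in F) x e.
Proof.
have /permPl perm := perm_sort (>=%R) [seq x e | e <- enum F].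
by rewrite (perm_big _ perm) big_map big_enum.
Qed.

(** Threshold counts give the weak inequality; it is strict because the sorted sequences have
    different sums. *)
Lemma decreasingly_smaller_pointwise x y :
  {in F, forall e, x e <= y e} -> (exists2 e, e \in F & x e < y e) ->
  decreasingly_smaller F x y.
Proof.
move=> xy [e0 e0F e0lt]; rewrite /decreasingly_smaller lt_neqAle; apply/andP; split.
  apply/eqP => eq_s; have := congr1 (fun s : seq R => \sum_(r <- s) r) eq_s.
  rewrite /= !sum_decr_seq; apply/eqP; rewrite lt_eqF //.
  rewrite [ltLHS](bigD1 e0) //= [ltRHS](bigD1 e0) //=.
  by apply: ltr_leD => //; apply: ler_sum => e /andP[eF _]; exact: xy.
apply: lexi_le_count; rewrite ?size_decr_seq //; try exact: decr_seq_sorted.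
move=> r; rewrite !count_sort !count_map.
rewrite -!sum1_count big_mkcond [leqRHS]big_mkcond !big_enum /=.
apply: leq_sum => e eF; case: ifP => // rx.
by rewrite (le_trans rx) // xy.
Qed.

(** The head of a sorted sequence is its maximum, and the lexicographic order compares heads
    first. *)
Lemma decr_seq_le_bound x y M :
  ((decr_seq F x : seqlexi R) <= (decr_seq F y : seqlexi R))%O ->
  {in F, forall e, y e <= M} -> {in F, forall e, x e <= M}.
Proof.
move=> le_xy yM e /(mem_decr_seq x).
have := decr_seq_sorted x; have : {in decr_seq F y, forall r, r <= M}.
  by move=> r; rewrite mem_sort => /mapP[e']; rewrite mem_enum => /yM ? ->.
have ge_trans : transitive (>=%R : rel R) by move=> u v w vu uw; exact: le_trans uw vu.
case: (decr_seq F x) le_xy => // a s; case: (decr_seq F y) => // b t.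
move=> /lexi_lehead ab tM /= /(order_path_min ge_trans)/allP sa.
have aM : a <= M by apply: (le_trans ab); rewrite tM ?mem_head.
by rewrite inE => /orP[/eqP->//|/sa/= /le_trans]; apply.
Qed.

End DecreasingOrder.

(** * Net in-flow of vertex sets *)

Section Flow.
Local Open Scope ring_scope.
Variables (R : realType) (V A : finType) (src tgt : A -> V).
Implicit Types (X : {set V}) (x : A -> R).

Lemma tsum_indicator (v : V) X : tsum (fun w => (w == v)%:R : R) X = (v \in X)%:R.
Proof.
rewrite /tsum; have [vX|vX] := boolP (v \in X).
  rewrite (bigD1 v) //= eqxx big1 ?addr0 // => w /andP[_ /negPf->] //.
by rewrite big1 // => w wX; case: eqP => // wv; rewrite -wv wX in vX.
Qed.

Lemma tsum_psi x X :
  tsum (psi src tgt x) X =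
    \sum_e x e * ((tgt e \in X)%:R - (src e \in X)%:R).
Proof.
rewrite /tsum.
transitivity (\sum_(v in X) \sum_e x e * ((v == tgt e)%:R - (v == src e)%:R)).
  apply: eq_bigr => v _; rewrite /psi big_mkcond [X in _ - X]big_mkcond -sumrB.
  apply: eq_bigr => e _; rewrite !(eq_sym v).
  by do 2 case: eqP => _; rewrite ?(mulr1, mulr0, subr0, sub0r, subrr, mulrN).
rewrite exchange_big; apply: eq_bigr => e _.
by rewrite -mulr_sumr sumrB -!/(tsum _ X) !tsum_indicator.
Qed.

Lemma tsum_psi_setT x : tsum (psi src tgt x) [set: V]%SET = 0.
Proof. by rewrite tsum_psi big1 // => e _; rewrite !finset.in_setT subrr mulr0. Qed.

End Flow.

(** * Set lattices recognised by separation of points *)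

Section Separation.
Local Open Scope ring_scope.
Variable V : finType.
Implicit Types X Y Z : {set V}.

(** [Z] is the union, over [u] in [Z], of the intersection of all members of [P] containing [u];
    separation keeps each such intersection inside [Z]. *)
Lemma separated_mem (P : pred {set V}) Z :
  P finset.set0 -> P [set: V]%SET ->
  (forall X Y, P X -> P Y -> P (X :&: Y)%SET) ->
  (forall X Y, P X -> P Y -> P (X :|: Y)%SET) ->
  (forall u v, u \in Z -> v \notin Z -> exists X, [/\ P X, u \in X & v \notin X]) ->
  P Z.
Proof.
move=> P0 PT PI PU sep.
suff -> : Z = (\bigcup_(u in Z) \bigcap_(X | P X && (u \in X)) X)%SET.
  by apply: (big_ind P) => // u _; apply: (big_ind P) => // X /andP[].
apply/setP => v; apply/idP/idP => [vZ|].
  by apply/bigcupP; exists v => //; apply/bigcapP => X /andP[].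
case/bigcupP => u uZ /bigcapP uv; apply: contraT => vZ.
have [X [PX uX vX]] := sep u v uZ vZ.
by move: (uv X); rewrite PX uX (negPf vX) => /(_ isT).
Qed.

End Separation.

(** * Sets bounded on [B] are those with finite [p] *)

Section Border.
Local Open Scope ring_scope.
Variables (R : realType) (V : finType) (p : {set V} -> \bar int).
Hypothesis p_border : supermodular_border p.
Hypothesis pT0 : p [set: V]%SET = 0%E.
Implicit Types (X Y Z : {set V}) (x : V -> R).

Lemma border_finE Z : p Z != -oo%E -> exists k : int, p Z = k%:E%E.
Proof. by case: p_border => pinf _ _ _; case: (p Z) (pinf Z) => // k _ _; exists k. Qed.

Lemma border_lattice X Y : p X != -oo%E -> p Y != -oo%E ->
  p (X :&: Y)%SET != -oo%E /\ p (X :|: Y)%SET != -oo%E.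
Proof.
case: p_border => pinf _ _ psup /border_finE[k pX] /border_finE[l pY].
have := psup X Y; rewrite pX pY.
by case: (p (X :&: Y)%SET) (pinf (X :&: Y)%SET) => [i||] //;
   case: (p (X :|: Y)%SET) (pinf (X :|: Y)%SET).
Qed.

Lemma border_separated Z :
  (forall u v, u \in Z -> v \notin Z ->
     exists X, [/\ p X != -oo%E, u \in X & v \notin X]) -> p Z != -oo%E.
Proof.
have [_ p0 _ _] := p_border.
apply: (@separated_mem V (fun X => p X != -oo%E)) => [||X Y pX pY|X Y pX pY].
- by rewrite p0.
- by rewrite pT0.
- by case: (border_lattice pX pY).
- by case: (border_lattice pX pY).
Qed.

Lemma base_polyhedron_ge x Z (k : int) :
  base_polyhedron p x -> p Z = k%:E%E -> k%:~R <= tsum x Z.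
Proof. by move=> [_ /(_ Z)] + pZ; rewrite pZ lee_fin. Qed.

(* If [p Z = -oo], then some [u] in [Z] and [v] outside [Z] are not separated by
   any set with finite [p], so [B] is stable under moving any amount from [u]
   to [v]. *)
Lemma bounded_setsE x Z : base_polyhedron p x ->
  (Z \in bounded_sets (base_polyhedron p : set (V -> R))) = (p Z != -oo%E).
Proof.
move=> Bx; rewrite finset.in_set; apply/idP/idP => [bZ|/border_finE[k pZ]]; last first.
  apply: (@lt_le_trans _ _ (k%:~R)%:E%E); first by rewrite ltNyr.
  apply/ereal_infP => _ [y By <-]; rewrite lee_fin; exact: base_polyhedron_ge By pZ.
apply: border_separated => u v uZ vZ; apply: contrapT => nsep.
have [r rinf] : exists r : R, (r%:E <= ereal_inf [set (tsum y Z)%:E | y in base_polyhedron p])%E.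
  move: bZ; case: (ereal_inf _) => [r _||]; [by exists r|by exists 0; rewrite leey|by rewrite ltxx].
have {rinf} inf_ge y : base_polyhedron p y -> r <= tsum y Z.
  by move=> By; rewrite -lee_fin (le_trans rinf) //; apply: ereal_inf_lbound; exists y.
(* Moving [t] from [u] to [v] brings the sum over [Z] down to [r - 1], below its lower bound [r]. *)
pose t := tsum x Z - r + 1.
have t_ge0 : 0 <= t by rewrite /t addr_ge0 // subr_ge0 inf_ge.
pose y w := x w + t * ((w == v)%:R - (w == u)%:R).
have yE X : tsum y X = tsum x X + t * ((v \in X)%:R - (u \in X)%:R).
  by rewrite -!(@tsum_indicator R) /tsum -sumrB mulr_sumr -big_split.
have /inf_ge : base_polyhedron p y.
  split=> [|X]; first by rewrite yE !finset.in_setT subrr mulr0 addr0; case: Bx.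
  case: (boolP (p X == -oo%E)) => [/eqP->|pX]; first by rewrite leNye.
  have [k pXk] := border_finE pX; rewrite pXk lee_fin yE.
  apply: (le_trans (base_polyhedron_ge Bx pXk)); rewrite lerDl mulr_ge0 // subr_ge0 ler_nat.
  case: (boolP (u \in X)) => // uX; case: (boolP (v \in X)) => // vX.
  by case: nsep; exists X.
by rewrite yE uZ (negPf vZ) sub0r mulrN1 /t; lra.
Qed.

End Border.

(** * Shifting a feasible vector along a circuit of [D^*] *)

Section Star.
Local Open Scope ring_scope.
Variables (R : realType) (V A : finType) (src tgt : A -> V).
Local Notation ssrc := (@star_src V A src tgt).
Local Notation stgt := (@star_tgt V A src tgt).
Local Notation adj := (fun a b => stgt a == ssrc b).
Implicit Types (c s : seq (star_edge V A)) (a b : star_edge V A).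

Lemma path_star_src_tgt (h : V -> R) a s : path adj a s ->
  \sum_(b <- s) h (ssrc b) = \sum_(b <- belast a s) h (stgt b).
Proof.
elim: s a => [|b s IH] a /=; first by rewrite !big_nil.
by case/andP => /eqP ab /IH; rewrite !big_cons ab => ->.
Qed.

Lemma cycle_star_sum (h : V -> R) c : cycle adj c ->
  \sum_(a <- c) (h (ssrc a) - h (stgt a)) = 0.
Proof.
case: c => [|a s]; first by rewrite big_nil.
move=> /= /(path_star_src_tgt h); rewrite belast_rcons sumrB -cats1 big_cat big_seq1 /=.
by rewrite !big_cons addrC => ->; rewrite subrr.
Qed.

Lemma sumr_all_ge0 T (P : pred T) (G : T -> R) (s : seq T) : all P s ->
  (forall i, P i -> 0 <= G i) -> 0 <= \sum_(i <- s) G i.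
Proof.
move=> + G0; elim: s => [|i s IH] /=; first by rewrite big_nil.
by case/andP => /G0 Gi /IH Gs; rewrite big_cons addr_ge0.
Qed.

Definition star_step a (e : A) : R :=
  match a with
  | Jump _ _ => 0
  | Keep e' => - (e == e')%:R
  | Rev e' => (e == e')%:R
  end.

Definition star_shift c (x : A -> R) (e : A) : R :=
  x e + \sum_(a <- c) star_step a e.

(** Since the copies in [A_2] are reversed, lowering a [Keep] edge and raising a [Rev] edge both
    move one unit of in-flow from the head to the tail of the edge of [D^*]. *)
Lemma tsum_psi_step a X : tsum (psi src tgt (star_step a)) X =
  if a is Jump _ _ then 0 else (ssrc a \in X)%:R - (stgt a \in X)%:R.
Proof.
rewrite tsum_psi; case: a => [u v|e|e] /=; first by rewrite big1 // => e _; rewrite mul0r.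
  rewrite (bigD1 e) //= eqxx big1 => [|e' /negPf->]; last by rewrite oppr0 mul0r.
  by rewrite addr0 mulN1r opprB.
rewrite (bigD1 e) //= eqxx big1 => [|e' /negPf->]; last by rewrite mul0r.
by rewrite addr0 mul1r.
Qed.

Lemma tsum_psi_shift c x X : tsum (psi src tgt (star_shift c x)) X =
  tsum (psi src tgt x) X + \sum_(a <- c) tsum (psi src tgt (star_step a)) X.
Proof.
under eq_bigr do rewrite tsum_psi.
rewrite !tsum_psi exchange_big -big_split; apply: eq_bigr => e _ /=.
by rewrite -mulr_suml -mulrDl.
Qed.

Variables (F : {set A}) (f g : A -> \bar int) (p : {set V} -> \bar int).
Hypotheses (p_border : supermodular_border p) (pT0 : p [set: V]%SET = 0%E).
Let B : set (V -> R) := base_polyhedron p.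

Lemma smallest_memberP (y : V -> R) u v : B y ->
  reflect (forall X, p X != -oo%E -> u \in X -> v \in X) (v \in smallest_member B u).
Proof.
move=> By; apply: (iffP bigcapP) => uv X.
  by move=> pX uX; apply: uv; rewrite (bounded_setsE p_border pT0 X By) pX.
by rewrite (bounded_setsE p_border pT0 X By) => /andP[]; exact: uv.
Qed.

Lemma star_shift_base c x : all (in_star F f g B) c -> cycle adj c ->
  B (psi src tgt x) -> B (psi src tgt (star_shift c x)).
Proof.
move=> c_star c_cycle Bx; split=> [|X].
  by rewrite tsum_psi_setT pT0.
case: (boolP (p X == -oo%E)) => [/eqP->|pX]; first by rewrite leNye.
have [k pXk] := border_finE p_border pX; rewrite pXk lee_fin.
apply: (le_trans (base_polyhedron_ge Bx pXk)); rewrite tsum_psi_shift lerDl.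
(* Subtracting the telescoping circuit sum, which is 0, cancels the terms of [A_1] and [A_2]. A
   jumping edge [uv] leaves [[v in X] - [u in X]], which is nonnegative because no jumping edge
   leaves a set with finite [p]. *)
rewrite -[leRHS]subr0 -[X in _ - X](cycle_star_sum (fun v => (v \in X)%:R) c_cycle) -sumrB.
apply: (sumr_all_ge0 c_star) => -[u v|e|e]; rewrite tsum_psi_step ?subrr //=.
rewrite finset.in_setD1 => /andP[_ /(smallest_memberP _ _ Bx) /(_ X pX) uv].
by rewrite sub0r opprB subr_ge0 ler_nat; case: (u \in X) uv => // ->.
Qed.

Lemma star_shift_ge c x e : all (in_star F f g B) c -> f e != -oo%E ->
  x e <= star_shift c x e.
Proof.
move=> c_star fe; rewrite lerDl (sumr_all_ge0 c_star) // => -[u v|e'|e'] //= fe'.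
by case: (e =P e') => [ee'|_]; rewrite ?oppr0 //; rewrite ee' fe' in fe.
Qed.

Lemma star_step_le0 a e : in_star F f g B a -> (e \in F) || (g e != +oo%E) ->
  star_step a e <= 0.
Proof.
case: a => [u v|e'|e'] /=; [by rewrite lexx|by rewrite oppr_le0 ler0n|].
case/andP => e'F ge'; case: (e =P e') => [->|]; last by rewrite lexx.
by rewrite (negPf e'F) ge'.
Qed.

Lemma star_shift_le c x e : all (in_star F f g B) c ->
  (e \in F) || (g e != +oo%E) -> star_shift c x e <= x e.
Proof.
move=> c_star eFg; rewrite gerDl -oppr_ge0 -sumrN (sumr_all_ge0 c_star) // => a ca.
by rewrite oppr_ge0 (star_step_le0 ca).
Qed.

(** An occurrence of [Keep e] with [e] in [F] contributes -1 at [e], and no other edge of [c] can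
    raise [e], since [A_2] avoids [F]. *)
Lemma star_shift_lt c x : all (in_star F f g B) c -> has (star_in_F F) c ->
  exists2 e, e \in F & star_shift c x e < x e.
Proof.
move=> c_star c_F.
have [c1 [e [c2 [cE eF]]]] : exists c1 e c2, c = c1 ++ Keep V e :: c2 /\ e \in F.
  elim: c c_F {c_star} => [|a c IH] //= /orP[|/IH[c1 [e [c2 [-> eF]]]]].
    by case: a => // e eF; exists [::], e, c.
  by exists (a :: c1), e, c2.
exists e => //; move: c_star; rewrite cE all_cat /= => /and3P[c1_star _ c2_star].
have le0 s : all (in_star F f g B) s -> \sum_(a <- s) star_step a e <= 0.
  by move=> s_star; rewrite -(gerDl (x e)) star_shift_le // eF.
rewrite gtrDl big_cat big_cons /= eqxx mulr1n.
by have := le0 _ c1_star; have := le0 _ c2_star; lra.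
Qed.

Lemma star_shift_int c x : @integer_points R A x -> @integer_points R A (star_shift c x).
Proof.
move=> x_int e; apply: rpredD => //; apply: rpred_sum => -[u v|e'|e'] _ /=.
- by rewrite rpred0.
- by rewrite rpredN rpred_nat.
- by rewrite rpred_nat.
Qed.

Lemma star_shift_Q c x : all (in_star F f g B) c -> cycle adj c ->
  Qset src tgt f g B x -> Qset src tgt f g B (star_shift c x).
Proof.
move=> c_star c_cycle [x_bnd Bx]; split; last exact: star_shift_base.
move=> e; have /andP[fx xg] := x_bnd e; apply/andP; split.
  case: (eqVneq (f e) -oo%E) => [->|fe]; first by rewrite leNye.
  by rewrite (le_trans fx) // lee_fin star_shift_ge.
case: (eqVneq (g e) +oo%E) => [->|ge]; first by rewrite leey.
by rewrite (le_trans _ xg) // lee_fin star_shift_le // ge orbT.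
Qed.

Lemma dec_min_no_circuit z :
  dec_min F (Qset src tgt f g B `&` @integer_points R A)%classic z ->
  ~ exists c, star_circuit src tgt F f g B c /\ has (star_in_F F) c.
Proof.
move=> [[zQ z_int] z_min] [c [[_ c_star c_cycle _] c_F]]; apply: z_min.
exists (star_shift c z); split; first split.
- exact: star_shift_Q.
- exact: star_shift_int.
- apply: decreasingly_smaller_pointwise; last exact: star_shift_lt.
  by move=> e eF; rewrite star_shift_le // eF.
Qed.

(** * Reachability in [D^*] and lower bounds on [F] *)

Definition star_rel : rel V := fun u v =>
  `[< exists a, [/\ in_star F f g B a, ssrc a = u & stgt a = v] >].

Lemma path_star_rel u (q : seq V) : path star_rel u q ->
  exists c, [/\ all (in_star F f g B) c, map ssrc c = belast u q & map stgt c = q].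
Proof.
elim: q u => [|v q IH] u /=; first by exists [::].
case/andP => /asboolP[a [a_star <- av]] /IH[c [c_star c_src c_tgt]].
by exists (a :: c); rewrite /= a_star c_star c_src c_tgt av.
Qed.

Lemma cycle_star c : map stgt c = rot 1 (map ssrc c) -> cycle adj c.
Proof.
case: c => [|a c] //=; rewrite rot1_cons -[ssrc a]/(ssrc a) -map_rcons.
(* The starting edge [d] is separated from the closing edge [b], so that the induction can advance
   [d] while [b] stays fixed. *)
move: (a) {2 4}a => d b; elim: c d => [|a' c IH] d /=.
  by case=> ->; rewrite eqxx.
by case=> -> /IH->; rewrite eqxx.
Qed.

(* [Z] is the set of vertices reachable from [tgt e] in [D^*]: a path from
   [tgt e] to [src e] would close up with [e] to a circuit, and [p Z] is finite
   because no jumping edge leaves [Z]. *)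
Lemma no_circuit_cut (y : V -> R) e : B y -> e \in F -> f e = -oo%E ->
  ~ (exists c, star_circuit src tgt F f g B c /\ has (star_in_F F) c) ->
  exists Z : {set V}, [/\ tgt e \in Z, src e \notin Z, p Z != -oo%E &
    forall a, in_star F f g B a -> ssrc a \in Z -> stgt a \in Z].
Proof.
move=> By eF fe nocirc.
pose Z := [set v | connect star_rel (tgt e) v]%SET.
have Z_closed a : in_star F f g B a -> ssrc a \in Z -> stgt a \in Z.
  move=> a_star; rewrite !finset.in_set => /connect_trans; apply; apply: connect1.
  by apply/asboolP; exists a.
exists Z; split=> //; first by rewrite finset.in_set connect0.
  rewrite finset.in_set; apply/negP => /connectP[s0 s0_path s0_last].
  (* A simple path is extracted because a circuit must have distinct tails. *)
  move: s0_last; case/shortenP: s0_path => s s_path s_uniq _ s_last.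
  have [c [c_star c_src c_tgt]] := path_star_rel s_path.
  apply: nocirc; exists (Keep V e :: c); rewrite /= eF; split=> //.
  have srcE : rcons (belast (tgt e) s) (src e) = tgt e :: s by rewrite s_last -lastI.
  split=> //=.
  - by rewrite fe c_star.
  - by apply: (@cycle_star (Keep V e :: c)); rewrite /= c_src c_tgt rot1_cons srcE.
  - by rewrite c_src -rcons_uniq srcE.
apply: (border_separated p_border pT0) => u v uZ vZ; apply: contrapT => nsep.
have uv : v \in smallest_member B u.
  apply/(smallest_memberP _ _ By) => X pX uX; apply: contrapT => /negP vX.
  by apply: nsep; exists X.
have := Z_closed (Jump A u v); rewrite /= finset.in_setD1 uv uZ (negPf vZ) andbT.
by case: (eqVneq v u) vZ => [->|_ _ /(_ isT isT)//]; rewrite uZ.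
Qed.

(* All terms of [psi x (Z) >= p Z] other than [x e] are bounded above. *)
Lemma no_circuit_lower_bound M e :
  (exists x, Qset src tgt f g B x) -> e \in F ->
  (forall e', f e' != +oo%E) -> (forall e', g e' != -oo%E) ->
  ~ (exists c, star_circuit src tgt F f g B c /\ has (star_in_F F) c) ->
  exists L : R, forall x, Qset src tgt f g B x ->
    {in F, forall e', x e' <= M} -> L <= x e.
Proof.
move=> [x0 [_ Bx0]] eF f_fin g_fin nocirc.
have f_le x e' : Qset src tgt f g B x -> f e' != -oo%E ->
    exists2 k : int, f e' = k%:E%E & k%:~R <= x e'.
  move=> [/(_ e')/andP[fx _] _]; case: (f e') fx (f_fin e') => // k.
  by rewrite lee_fin => ? _ _; exists k.
case: (boolP (f e == -oo%E)) => [/eqP fe|fe]; last first.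
  have [k fk] : exists k : int, f e = k%:E%E by case: (f e) (f_fin e) fe => // k; exists k.
  by exists k%:~R => x xQ _; have [k'] := f_le _ _ xQ fe; rewrite fk => -[->].
have [Z [tZ sZ pZ Z_closed]] := no_circuit_cut Bx0 eF fe nocirc.
have [k pZk] := border_finE p_border pZ.
pose coef e' : R := (tgt e' \in Z)%:R - (src e' \in Z)%:R.
have /choice[h hP] : forall e', exists h : R, forall x, Qset src tgt f g B x ->
    {in F, forall e', x e' <= M} -> e' != e -> x e' * coef e' <= h.
  (* An edge leaving [Z] has finite [f], or its copy in [A_1] would leave [Z]. An edge outside [F]
     entering [Z] has finite [g], or its reversed copy in [A_2] would leave [Z]. Entering edges of
     [F] are bounded by [M]. *)
  move=> e'; rewrite /coef; case: (boolP (src e' \in Z)) => se'; case: (boolP (tgt e' \in Z)) => te'.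
  - by exists 0 => x _ _ _; rewrite subrr mulr0.
  - have fe' : f e' != -oo%E.
      by apply: contra te' => fe'; apply: (Z_closed (Keep V e')).
    have [l fl] : exists l : int, f e' = l%:E%E by case: (f e') (f_fin e') fe' => // l; exists l.
    exists (- l%:~R) => x xQ _ _; have [l'] := f_le _ _ xQ fe'.
    by rewrite fl => -[->]; rewrite sub0r mulrN1 lerN2.
  - case: (boolP (e' \in F)) => e'F.
      by exists M => x _ xM _; rewrite subr0 mulr1 xM.
    have ge' : g e' != +oo%E.
      by apply: contra se' => ge'; apply: (Z_closed (Rev V e')) => //=; rewrite e'F.
    have [l gl] : exists l : int, g e' = l%:E%E by case: (g e') (g_fin e') ge' => // l; exists l.
    exists l%:~R => x [/(_ e')/andP[_ +] _] _ _.
    by rewrite gl lee_fin subr0 mulr1.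
  - by exists 0 => x _ _ _; rewrite subrr mulr0.
exists (k%:~R - \sum_(e' | e' != e) h e') => x xQ xM; rewrite lerBlDr.
have [_ Bx] := xQ; apply: (le_trans (base_polyhedron_ge Bx pZk)).
rewrite tsum_psi (bigD1 e) //= tZ (negPf sZ) subr0 mulr1 lerD2l.
by apply: ler_sum => e' e'e; exact: hP.
Qed.

End Star.

(** * Existence of a minimum from bounds on [F] *)

Section LexicographicMinimum.
Local Open Scope ring_scope.
Variables (R : realType) (A : finType) (F : {set A}).

(** The sorted sequence depends only on the values on [F]. For points not worse than [x0] these are
    integers in [[-N, N]], so the minimum is taken over a finite type of value vectors. *)
Lemma dec_min_exists (S : set (A -> R)) x0 (N : nat) :
  S x0 -> (forall x, S x -> @integer_points R A x) ->
  (forall x, S x -> ((decr_seq F x : seqlexi R) <= (decr_seq F x0 : seqlexi R))%O ->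
     {in F, forall e, - N%:R <= x e <= N%:R}) ->
  exists z, dec_min F S z.
Proof.
move=> Sx0 S_int S_bnd.
(* The [2N + 1] indices, shifted down by [N], are the integers from [-N] to [N]; entries off [F] are
   arbitrary. *)
pose val (t : {ffun A -> 'I_(N + N).+1}) e : R := (t e : nat)%:R - N%:R.
have encode x : S x -> ((decr_seq F x : seqlexi R) <= (decr_seq F x0 : seqlexi R))%O ->
    exists t, {in F, x =1 val t}.
  move=> Sx x_le.
  have /choice[t tP] : forall e, exists i : 'I_(N + N).+1, e \in F -> x e = (i : nat)%:R - N%:R.
    move=> e; case: (boolP (e \in F)) => eF; last by exists ord0.
    have /andP[lo hi] := S_bnd x Sx x_le e eF.
    have /natrP[n nE] : x e + N%:R \is a Num.nat.
      by rewrite natrEint rpredD ?rpred_nat ?S_int //= -lerBlDr sub0r.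
    have n_lt : (n < (N + N).+1)%N by rewrite ltnS -(ler_nat R) -nE natrD lerD2r.
    by exists (Ordinal n_lt) => _; rewrite -nE addrK.
  by exists [ffun e => t e] => e eF; rewrite /val ffunE; exact: tP.
pose attained t := `[< exists2 x, S x & {in F, x =1 val t} >].
have [t0 t0E] := encode x0 Sx0 (lexx _).
have t0_att : attained t0 by apply/asboolP; exists x0.
case: (@Order.TotalTheory.arg_minP _ _ _ t0 attained
  (fun t => decr_seq F (val t) : seqlexi R) t0_att) => t /asboolP[z Sz zE] t_min.
exists z; split=> // -[x [Sx]]; rewrite /decreasingly_smaller (eq_decr_seq zE) => x_lt.
(* A point better than [z] is also not worse than [x0], hence is encoded and contradicts the
   minimality of [t]. *)
have x_le : ((decr_seq F x : seqlexi R) <= (decr_seq F x0 : seqlexi R))%O.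
  by apply: (le_trans (ltW x_lt)); rewrite (eq_decr_seq t0E) t_min.
have [t' t'E] := encode x Sx x_le.
have /t_min : attained t' by apply/asboolP; exists x.
by rewrite leNgt -(eq_decr_seq t'E) x_lt.
Qed.

End LexicographicMinimum.

Theorem theorem6p2 (R : realType) (V A : finType) (src tgt : A -> V)
    (loopless : forall e : A, src e != tgt e)
    (F : {set A}) (F_nonempty : F != finset.set0)
    (B : set (V -> R)) (B_base : integral_0_base_polyhedron B)
    (f g : A -> \bar int)
    (f_lt_pinfty : forall e : A, f e != +oo%E)
    (g_gt_ninfty : forall e : A, g e != -oo%E)
    (f_le_g : forall e : A, (f e <= g e)%E)
    (Q_nonempty : exists x : A -> R,
        (Qset src tgt f g B `&` @integer_points R A)%classic x) :
  (exists z : A -> R,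
      dec_min F (Qset src tgt f g B `&` @integer_points R A)%classic z) <->
  ~ (exists c : seq (star_edge V A),
        star_circuit src tgt F f g B c /\ has (star_in_F F) c).
Proof.
have [p [p_border pT0 BE]] := B_base; subst B.
split=> [[z /(dec_min_no_circuit p_border pT0)]//|nocirc].
have [x0 [x0Q x0_int]] := Q_nonempty.
pose M : R := (\sum_(e in F) `|x0 e|)%R.
have x0_le : {in F, forall e, (x0 e <= M)%R}.
  move=> e eF; rewrite (le_trans (ler_norm _)) // /M (bigD1 e) //= lerDl.
  by apply: sumr_ge0 => e' _; exact: normr_ge0.
have /choice[L LP] : forall e, exists L : R, e \in F ->
    forall x, Qset src tgt f g (base_polyhedron p) x ->
      {in F, forall e', (x e' <= M)%R} -> (L <= x e)%R.
  move=> e; case: (boolP (e \in F)) => eF; last by exists 0%R.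
  have [|L LP] := no_circuit_lower_bound p_border pT0 M _ eF f_lt_pinfty g_gt_ninfty nocirc.
    by exists x0.
  by exists L.
(* [K] dominates both the upper bound [M] and every [|L e|] with [e] in [F], so one integer above it
   bounds all values on [F] in absolute value. *)
pose K : R := (M + \sum_(e in F) `|L e|)%R.
have M_ge0 : (0 <= M)%R by apply: sumr_ge0 => e _; exact: normr_ge0.
have sumL_ge0 : (0 <= \sum_(e in F) `|L e|)%R by apply: sumr_ge0 => e _; exact: normr_ge0.
have K_lt : (K < (Num.bound K)%:R)%R by apply: archi_boundP; rewrite addr_ge0.
apply: (@dec_min_exists R A F _ x0 (Num.bound K)) => // [x [] //|x [xQ _] x_le e eF].
have xM := decr_seq_le_bound x_le x0_le.
apply/andP; split; last by rewrite (le_trans (xM e eF)) // (le_trans _ (ltW K_lt)) // lerDl.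
rewrite (le_trans _ (LP e eF x xQ xM)) // lerNl (le_trans _ (ltW K_lt)) //.
rewrite (le_trans (ler_norm _)) // normrN /K (bigD1 e) //= addrCA lerDl addr_ge0 //.
by apply: sumr_ge0 => e' _; exact: normr_ge0.
Qed.
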